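(* Let $S=[Y;B_\alpha;\phi_{\alpha,\beta}]$ be a dual weak brace. For each $\alpha\in Y$ let $I_\alpha$ be an ideal of the skew brace $B_\alpha$, and set $\psi_{\alpha,\beta}:={\phi_{\alpha,\beta}}|_{I_\alpha}$ for all $\alpha\ge\beta$. If $\phi_{\alpha,\beta}(I_\alpha)\subseteq I_\beta$ for all $\alpha>\beta$, then $I=[Y;I_\alpha;\psi_{\alpha,\beta}]$ (that is, $I=\bigcup_{\alpha\in Y}I_\alpha$ with the operations of $S$) is an ideal of $S$. Conversely, every ideal of $S$ is of this form.
   Context: A dual weak brace is a triple $(S,+,\circ)$ such that $(S,+)$ is an inverse semigroup, $(S,\circ)$ is a Clifford semigroup (inverse semigroup with central idempotents), and $a\circ(b+c)=a\circ b-a+a\circ c$, $a\circ a^-=-a+a$ for all $a,b,c$, where $-a$, $a^-$ are the inverses of $a$ in $(S,+)$, $(S,\circ)$; then $(S,+)$ is also Clifford and the idempotents of both operations coincide, their set being $\mathrm{E}(S)$. A skew brace is a dual weak brace with exactly one idempotent (both structures are groups). Put $\lambda_a(b)=-a+a\circ b$. Notation $S=[Y;B_\alpha;\phi_{\alpha,\beta}]$: $Y$ is a (lower) semilattice, the $B_\alpha$ ($\alpha\in Y$) are pairwise disjoint skew braces, $\phi_{\alpha,\beta}:B_\alpha\to B_\beta$ ($\alpha\ge\beta$) are skew brace homomorphisms with $\phi_{\alpha,\alpha}=\mathrm{id}$ and $\phi_{\beta,\gamma}\phi_{\alpha,\beta}=\phi_{\alpha,\gamma}$ for $\alpha\ge\beta\ge\gamma$,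 and $S=\bigcup_\alpha B_\alpha$ with $a+b=\phi_{\alpha,\alpha\beta}(a)+\phi_{\beta,\alpha\beta}(b)$, $a\circ b=\phi_{\alpha,\alpha\beta}(a)\circ\phi_{\beta,\alpha\beta}(b)$ for $a\in B_\alpha,b\in B_\beta$; every dual weak brace is of this form. A normal subsemigroup of a Clifford semigroup $T$ is a subset $I$ containing all idempotents of $T$, closed under products and inverses, with $a^{-1}Ia\subseteq I$ for all $a\in T$. An ideal of a dual weak brace $S$ (in particular of a skew brace) is a subset $I$ that is a normal subsemigroup of both $(S,+)$ and $(S,\circ)$ and satisfies $\lambda_a(I)\subseteq I$ for all $a\in S$. *)

(* Defs.v *)
From HB Require Import structures.
From mathcomp Require Import all_boot all_order.
From mathcomp Require Import boolp classical_sets.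

Set Implicit Arguments.
Unset Strict Implicit.
Unset Printing Implicit Defensive.

Import Order.LTheory.
Local Open Scope order_scope.
Local Open Scope classical_set_scope.

Section Semigroups.
Variables (T : Type) (op : T -> T -> T) (inv : T -> T).

(* [inv a] is the unique [b] such that a b a = a and b a b = b. *)
Definition inverse_semigroup : Prop :=
  [/\ associative op,
      forall a, op (op a (inv a)) a = a,
      forall a, op (op (inv a) a) (inv a) = inv a
    & forall a b, op (op a b) a = a -> op (op b a) b = b -> b = inv a].

Definition clifford_semigroup : Prop :=
  inverse_semigroup /\ (forall e a, op e e = e -> op e a = op a e).

Definition normal_subsemigroup (I : set T) : Prop :=
  [/\ forall e, op e e = e -> I e,
      forall x y, I x -> I y -> I (op x y),
      forall x, I x -> I (inv x)
    & forall a x, I x -> I (op (op (inv a) x) a)].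

End Semigroups.

Declare Scope brace_scope.
Delimit Scope brace_scope with brace.
Local Open Scope brace_scope.

HB.mixin Record isDualWeakBrace S := {
  badd : S -> S -> S;
  bopp : S -> S;
  bmul : S -> S -> S;
  binv : S -> S;
  badd_inverse : inverse_semigroup badd bopp;
  bmul_clifford : clifford_semigroup bmul binv;
  bmulDr : forall a b c,
    bmul a (badd b c) = badd (badd (bmul a b) (bopp a)) (bmul a c);
  bmulV : forall a, bmul a (binv a) = badd (bopp a) a
}.

#[short(type="dualWeakBraceType")]
HB.structure Definition DualWeakBrace := { S of isDualWeakBrace S }.

Notation "a + b" := (badd a b) : brace_scope.
Notation "- a" := (bopp a) : brace_scope.
Notation "a - b" := (badd a (bopp b)) : brace_scope.
Notation "a ∘ b" := (bmul a b) (at level 40, left associativity) : brace_scope.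

(* Both operations of a dual weak brace have the same idempotents. *)
HB.mixin Record DualWeakBrace_isSkewBrace S of DualWeakBrace S := {
  idem_uniq : exists! e : S, badd e e = e
}.

#[short(type="skewBraceType")]
HB.structure Definition SkewBrace :=
  { S of DualWeakBrace S & DualWeakBrace_isSkewBrace S }.

Definition lambda (S : dualWeakBraceType) (a b : S) : S := - a + a ∘ b.

Definition ideal (S : dualWeakBraceType) (I : set S) : Prop :=
  [/\ normal_subsemigroup (@badd S) (@bopp S) I,
      normal_subsemigroup (@bmul S) (@binv S) I
    & forall a x : S, I x -> I (lambda a x)].

Definition brace_hom (S T : dualWeakBraceType) (f : S -> T) : Prop :=
  (forall a b, f (a + b) = f a + f b) /\ (forall a b, f (a ∘ b) = f a ∘ f b).

(* [transition] takes a proof of [β <= α]; such proofs are unique, so it is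
   a single map from the component at α to the component at β. *)
Record braceSystem (d : Order.disp_t) (Y : meetSemilatticeType d) := BraceSystem {
  component :> Y -> skewBraceType;
  transition : forall α β : Y, β <= α -> component α -> component β;
  transition_hom : forall (α β : Y) (h : β <= α), brace_hom (transition h);
  transition_id : forall (α : Y) (h : α <= α) x, transition h x = x;
  transition_comp : forall (α β γ : Y) (h : β <= α) (k : γ <= β) (l : γ <= α) x,
    transition k (transition h x) = transition l x
}.

Arguments transition {d Y b α β} h x.
Arguments transition_hom {d Y b α β} h.
Arguments transition_id {d Y b α} h x.
Arguments transition_comp {d Y b α β γ} h k l x.

Section StrongSemilattice.
Variables (d : Order.disp_t) (Y : meetSemilatticeType d) (B : braceSystem Y).

Definition strongSemilattice : Type := {α : Y & B α}.

Definition inject (α : Y) (x : B α) : strongSemilattice := existT _ α x.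

Definition ss_add (a b : strongSemilattice) : strongSemilattice :=
  inject (transition (leIl (tag a) (tag b)) (tagged a)
          + transition (leIr (tag b) (tag a)) (tagged b)).
Definition ss_opp (a : strongSemilattice) : strongSemilattice :=
  inject (- tagged a).
Definition ss_mul (a b : strongSemilattice) : strongSemilattice :=
  inject (transition (leIl (tag a) (tag b)) (tagged a)
          ∘ transition (leIr (tag b) (tag a)) (tagged b)).
Definition ss_inv (a : strongSemilattice) : strongSemilattice :=
  inject (binv (tagged a)).

Let push (δ : Y) (a : strongSemilattice) (h : δ <= tag a) : B δ :=
  transition h (tagged a).

Lemma ss_eq (a b : strongSemilattice) : tag a = tag b ->
  (forall δ (h : δ <= tag a) (k : δ <= tag b), push h = push k) -> a = b.
Proof.
case: a b => [α x] [β y] /= e; case: β / e y => y H.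
by have := H α (lexx α) (lexx α); rewrite /push /= !transition_id => ->.
Qed.

Lemma push_add δ a b (h : δ <= tag (ss_add a b)) (k : δ <= tag a)
  (l : δ <= tag b) : push h = push k + push l.
Proof.
rewrite /push /= (proj1 (transition_hom h)).
by congr (_ _ _); exact: transition_comp.
Qed.

Lemma push_mul δ a b (h : δ <= tag (ss_mul a b)) (k : δ <= tag a)
  (l : δ <= tag b) : push h = push k ∘ push l.
Proof.
rewrite /push /= (proj2 (transition_hom h)).
by congr (_ _ _); exact: transition_comp.
Qed.

Lemma inv_hom (T U : Type) (op : T -> T -> T) (inv : T -> T)
  (op' : U -> U -> U) (inv' : U -> U) (f : T -> U) :
  inverse_semigroup op inv -> inverse_semigroup op' inv' ->
  (forall a b, f (op a b) = op' (f a) (f b)) ->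
  forall a, f (inv a) = inv' (f a).
Proof.
by move=> [_ Hi Hv _] [_ _ _ U'] Hf a; apply: U'; rewrite -!Hf ?Hi ?Hv.
Qed.

Lemma push_opp δ a (h : δ <= tag (ss_opp a)) (k : δ <= tag a) :
  push h = - push k.
Proof.
rewrite /push /= (bool_irrelevance h k).
exact: inv_hom (badd_inverse) (badd_inverse) (transition_hom k).1 _.
Qed.

Lemma push_inv δ a (h : δ <= tag (ss_inv a)) (k : δ <= tag a) :
  push h = binv (push k).
Proof.
rewrite /push /= (bool_irrelevance h k).
exact: inv_hom (proj1 bmul_clifford) (proj1 bmul_clifford) (transition_hom k).2 _.
Qed.

Lemma ss_inverse_tag (op : strongSemilattice -> strongSemilattice -> strongSemilattice)
  (a b : strongSemilattice) :
  (forall a b, tag (op a b) = (tag a `&` tag b)%O) ->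
  op (op a b) a = a -> op (op b a) b = b -> tag a = tag b.
Proof.
move=> H /(congr1 tag); rewrite !H => Ea /(congr1 tag); rewrite !H => Eb.
apply/le_anti/andP; split.
  by rewrite -Ea -meetA meetCA leIl.
by rewrite -Eb -meetA meetCA leIl.
Qed.

Lemma ss_add_inverse : inverse_semigroup ss_add ss_opp.
Proof.
split=> [a b c|a|a|a b Ea Eb].
- apply: ss_eq => [|δ h k]; first by rewrite /= meetA.
  have := h; rewrite /= !lexI => /and3P[ha hb hc].
  have hbc : δ <= tag (ss_add b c) by rewrite /= lexI hb.
  have hab : δ <= tag (ss_add a b) by rewrite /= lexI ha.
  rewrite (push_add h ha hbc) (push_add hbc hb hc).
  rewrite (push_add k hab hc) (push_add hab ha hb).
  by case: (@badd_inverse (B δ)).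
- apply: ss_eq => [|δ h k]; first by rewrite /= !meetxx.
  have hn : δ <= tag (ss_opp a) by [].
  have han : δ <= tag (ss_add a (ss_opp a)) by rewrite /= lexI k.
  rewrite (push_add h han k) (push_add han k hn) (push_opp hn k).
  by case: (@badd_inverse (B δ)).
- apply: ss_eq => [|δ h k]; first by rewrite /= !meetxx.
  have ha : δ <= tag a by [].
  have han : δ <= tag (ss_add (ss_opp a) a) by rewrite /= lexI k.
  rewrite (push_add h han k) (push_add han k ha) (push_opp k ha).
  by case: (@badd_inverse (B δ)).
have e : tag a = tag b by apply: ss_inverse_tag Ea Eb.
apply: ss_eq => [|δ hb ho]; first by rewrite /= e.
have ha : δ <= tag a by [].
have hab : δ <= tag (ss_add a b) by rewrite /= lexI ha.
have hba : δ <= tag (ss_add b a) by rewrite /= lexI hb.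
have haba : δ <= tag (ss_add (ss_add a b) a) by rewrite /= !lexI ha hb.
have hbab : δ <= tag (ss_add (ss_add b a) b) by rewrite /= !lexI ha hb.
have E1 : push haba = push ha.
  by move: haba; rewrite Ea => h; rewrite (bool_irrelevance h ha).
have E2 : push hbab = push hb.
  by move: hbab; rewrite Eb => h; rewrite (bool_irrelevance h hb).
rewrite (push_opp ho ha).
have [_ _ _ U] := @badd_inverse (B δ); apply: U.
  by rewrite -[RHS]E1 (push_add haba hab ha) (push_add hab ha hb).
by rewrite -[RHS]E2 (push_add hbab hba hb) (push_add hba hb ha).
Qed.

Lemma ss_mul_clifford : clifford_semigroup ss_mul ss_inv.
Proof.
split; last first.
  move=> e a Ee; apply: ss_eq => [|δ h k]; first by rewrite /= meetC.
  have := h; rewrite /= lexI => /andP[he ha].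
  have hee : δ <= tag (ss_mul e e) by rewrite /= lexI he.
  rewrite (push_mul h he ha) (push_mul k ha he).
  have [_ C] := @bmul_clifford (B δ); apply: C.
  by rewrite -(push_mul hee he he); move: hee; rewrite Ee => h';
    rewrite (bool_irrelevance h' he).
split=> [a b c|a|a|a b Ea Eb].
- apply: ss_eq => [|δ h k]; first by rewrite /= meetA.
  have := h; rewrite /= !lexI => /and3P[ha hb hc].
  have hbc : δ <= tag (ss_mul b c) by rewrite /= lexI hb.
  have hab : δ <= tag (ss_mul a b) by rewrite /= lexI ha.
  rewrite (push_mul h ha hbc) (push_mul hbc hb hc).
  rewrite (push_mul k hab hc) (push_mul hab ha hb).
  by case: (proj1 (@bmul_clifford (B δ))).
- apply: ss_eq => [|δ h k]; first by rewrite /= !meetxx.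
  have hn : δ <= tag (ss_inv a) by [].
  have han : δ <= tag (ss_mul a (ss_inv a)) by rewrite /= lexI k.
  rewrite (push_mul h han k) (push_mul han k hn) (push_inv hn k).
  by case: (proj1 (@bmul_clifford (B δ))).
- apply: ss_eq => [|δ h k]; first by rewrite /= !meetxx.
  have ha : δ <= tag a by [].
  have han : δ <= tag (ss_mul (ss_inv a) a) by rewrite /= lexI k.
  rewrite (push_mul h han k) (push_mul han k ha) (push_inv k ha).
  by case: (proj1 (@bmul_clifford (B δ))).
have e : tag a = tag b by apply: ss_inverse_tag Ea Eb.
apply: ss_eq => [|δ hb ho]; first by rewrite /= e.
have ha : δ <= tag a by [].
have hab : δ <= tag (ss_mul a b) by rewrite /= lexI ha.
have hba : δ <= tag (ss_mul b a) by rewrite /= lexI hb.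
have haba : δ <= tag (ss_mul (ss_mul a b) a) by rewrite /= !lexI ha hb.
have hbab : δ <= tag (ss_mul (ss_mul b a) b) by rewrite /= !lexI ha hb.
have E1 : push haba = push ha.
  by move: haba; rewrite Ea => h; rewrite (bool_irrelevance h ha).
have E2 : push hbab = push hb.
  by move: hbab; rewrite Eb => h; rewrite (bool_irrelevance h hb).
rewrite (push_inv ho ha).
have [_ _ _ U] := proj1 (@bmul_clifford (B δ)); apply: U.
  by rewrite -[RHS]E1 (push_mul haba hab ha) (push_mul hab ha hb).
by rewrite -[RHS]E2 (push_mul hbab hba hb) (push_mul hba hb ha).
Qed.

Lemma ss_mulDr a b c :
  ss_mul a (ss_add b c) = ss_add (ss_add (ss_mul a b) (ss_opp a)) (ss_mul a c).
Proof.
apply: ss_eq => [|δ h k].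
  by rewrite /= (meetAC (tag a) (tag b)) meetxx meetACA meetxx.
have := h; rewrite /= !lexI => /and3P[ha hb hc].
have hbc : δ <= tag (ss_add b c) by rewrite /= lexI hb.
have hab : δ <= tag (ss_mul a b) by rewrite /= lexI ha.
have hac : δ <= tag (ss_mul a c) by rewrite /= lexI ha.
have hn : δ <= tag (ss_opp a) by [].
have habn : δ <= tag (ss_add (ss_mul a b) (ss_opp a)) by rewrite /= !lexI ha hb.
rewrite (push_mul h ha hbc) (push_add hbc hb hc).
rewrite (push_add k habn hac) (push_add habn hab hn) (push_opp hn ha).
by rewrite (push_mul hab ha hb) (push_mul hac ha hc) bmulDr.
Qed.

Lemma ss_mulV a : ss_mul a (ss_inv a) = ss_add (ss_opp a) a.
Proof.
apply: ss_eq => [|δ h k]; first by [].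
have := h; rewrite /= !lexI => /andP[ha _].
have hn : δ <= tag (ss_opp a) by [].
have hi : δ <= tag (ss_inv a) by [].
rewrite (push_mul h ha hi) (push_add k hn ha) (push_opp hn ha) (push_inv hi ha).
exact: bmulV.
Qed.

HB.instance Definition _ := isDualWeakBrace.Build strongSemilattice
  ss_add_inverse ss_mul_clifford ss_mulDr ss_mulV.

End StrongSemilattice.

Section SubBrace.
Variables (S : skewBraceType) (I : set S) (idI : ideal I).

Definition subBrace of ideal I : Type := {x : S | I x}.
Local Notation T := (subBrace idI).

Lemma sub_eq (x y : T) : sval x = sval y -> x = y.
Proof.
case: x y => [x p] [y q] /= e; case: y / e q => q.
by rewrite (Prop_irrelevance p q).
Qed.

Definition sub_add (x y : T) : T :=
  exist I (sval x + sval y)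
    (let: And3 (And4 _ H _ _) _ _ := idI in H _ _ (svalP x) (svalP y)).
Definition sub_opp (x : T) : T :=
  exist I (- sval x) (let: And3 (And4 _ _ H _) _ _ := idI in H _ (svalP x)).
Definition sub_mul (x y : T) : T :=
  exist I (sval x ∘ sval y)
    (let: And3 _ (And4 _ H _ _) _ := idI in H _ _ (svalP x) (svalP y)).
Definition sub_inv (x : T) : T :=
  exist I (binv (sval x)) (let: And3 _ (And4 _ _ H _) _ := idI in H _ (svalP x)).

Lemma sub_add_inverse : inverse_semigroup sub_add sub_opp.
Proof.
have [A V1 V2 U] := @badd_inverse S.
split=> [a b c|a|a|a b Ea Eb]; apply: sub_eq => /=; [exact: A|exact: V1|exact: V2|].
by apply: U; [exact: (congr1 sval Ea) | exact: (congr1 sval Eb)].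
Qed.

Lemma sub_mul_clifford : clifford_semigroup sub_mul sub_inv.
Proof.
have [[A V1 V2 U] C] := @bmul_clifford S.
split; last by move=> e a Ee; apply/sub_eq/C/(congr1 sval Ee).
split=> [a b c|a|a|a b Ea Eb]; apply: sub_eq => /=; [exact: A|exact: V1|exact: V2|].
by apply: U; [exact: (congr1 sval Ea) | exact: (congr1 sval Eb)].
Qed.

Lemma sub_mulDr a b c :
  sub_mul a (sub_add b c)
  = sub_add (sub_add (sub_mul a b) (sub_opp a)) (sub_mul a c).
Proof. exact/sub_eq/bmulDr. Qed.

Lemma sub_mulV a : sub_mul a (sub_inv a) = sub_add (sub_opp a) a.
Proof. exact/sub_eq/bmulV. Qed.

HB.instance Definition _ := isDualWeakBrace.Build T
  sub_add_inverse sub_mul_clifford sub_mulDr sub_mulV.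

Lemma sub_idem_uniq : exists! e : T, badd e e = e.
Proof.
have [e [He Ue]] := @idem_uniq S; have [[Hid _ _ _] _ _] := idI.
exists (exist I e (Hid _ He)); split; first exact: sub_eq.
by move=> f Hf; apply/sub_eq/Ue/(congr1 sval Hf).
Qed.

HB.instance Definition _ := DualWeakBrace_isSkewBrace.Build T sub_idem_uniq.

End SubBrace.

Section Restriction.
Variables (d : Order.disp_t) (Y : meetSemilatticeType d) (B : braceSystem Y).
Variable I : forall α, set (B α).
Arguments I : clear implicits.
Variable idI : forall α, ideal (I α).
Hypothesis stI : forall (α β : Y) (h : β < α),
  transition (ltW h) @` I α `<=` I β.

Lemma transition_stable (α β : Y) (h : β <= α) x :
  I α x -> I β (transition h x).
Proof.
move=> Ix; case: (eqVneq β α) => [e|ne].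
  by subst β; rewrite transition_id.
have lt : β < α by rewrite lt_neqAle ne.
by rewrite (bool_irrelevance h (ltW lt)); apply: (stI (h := lt)); exists x.
Qed.

Definition res_transition (α β : Y) (h : β <= α) (x : subBrace (idI α)) :
  subBrace (idI β) :=
  exist (I β) (transition h (sval x)) (transition_stable h (svalP x)).

Lemma res_hom (α β : Y) (h : β <= α) : brace_hom (res_transition h).
Proof.
split=> a b; apply: sub_eq; first exact: (proj1 (transition_hom h)).
exact: (proj2 (transition_hom h)).
Qed.

Lemma res_id (α : Y) (h : α <= α) x : res_transition h x = x.
Proof. exact/sub_eq/transition_id. Qed.

Lemma res_comp (α β γ : Y) (h : β <= α) (k : γ <= β) (l : γ <= α) x :
  res_transition k (res_transition h x) = res_transition l x.
Proof. exact/sub_eq/transition_comp. Qed.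

Definition restriction : braceSystem Y :=
  @BraceSystem d Y (fun α => subBrace (idI α) : skewBraceType) res_transition
    res_hom res_id res_comp.

Definition inclusion (x : strongSemilattice restriction) : strongSemilattice B :=
  inject (sval (tagged x)).

(* The subset [J], with the operations of the ambient dual weak brace, is
   the strong semilattice of the [I α] and the restricted transition maps. *)
Definition is_restriction (J : set (strongSemilattice B)) : Prop :=
  [/\ brace_hom inclusion, injective inclusion & range inclusion = J].

End Restriction.

(* Main.v *)
Require Import Defs.
From HB Require Import structures.
From mathcomp Require Import all_boot all_order.
From mathcomp Require Import boolp classical_sets.

Set Implicit Arguments.
Unset Strict Implicit.
Unset Printing Implicit Defensive.

Import Order.LTheory.
Local Open Scope order_scope.
Local Open Scope classical_set_scope.

(** Every operation of S takes place in a single component, after transitions have carried the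
    arguments there. For the direct statement, [bigcup_injectE] reads membership in the union off
    one component, and stability under transitions keeps the carried elements inside the given
    ideals. Each closure condition in [ideal_bigcup] thus becomes the same condition for one [I γ],
    with γ a meet of indices. For the converse, the slices [component_part] are preimages of J under
    the embeddings [inject], hence ideals, and J is their union. The point is their compatibility
    with transitions, [component_part_stable]: adding to x the zero of a lower component gives the
    image of x there, and J contains all idempotents. *)

Section IdealsOfStrongSemilattices.
Variables (d : Order.disp_t) (Y : meetSemilatticeType d) (B : braceSystem Y).
Local Open Scope brace_scope.
Implicit Types α β γ δ : Y.
Local Notation S := (strongSemilattice B).

Lemma transition_opp α β (h : β <= α) (x : B α) :
  transition h (- x) = - transition h x.
Proof. exact: inv_hom badd_inverse badd_inverse (transition_hom h).1 x. Qed.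

Lemma transition_inv α β (h : β <= α) (x : B α) :
  transition h (binv x) = binv (transition h x).
Proof.
exact: inv_hom (proj1 bmul_clifford) (proj1 bmul_clifford)
  (transition_hom h).2 x.
Qed.

(** Fixing the composite inequality as [le_trans k h] turns functoriality into a rewrite rule
    without side goals. *)
Lemma transition_trans α β γ (h : β <= α) (k : γ <= β) (x : B α) :
  transition k (transition h x) = transition (le_trans k h) x.
Proof. exact: transition_comp. Qed.

Lemma inject_inj α : injective (@inject d Y B α).
Proof. by move=> x y; apply: eq_from_Tagged. Qed.

Lemma inject_add α (x y : B α) : inject x + inject y = inject (x + y) :> S.
Proof.
(* The meet of α with itself equals α only propositionally; generalising the inequality proofs lets
   [meetxx] rewrite the types. *)
rewrite [LHS]/badd /= /ss_add /=; move: (leIl _ _) (leIr _ _).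
by rewrite meetxx => h k; rewrite !transition_id.
Qed.

Lemma inject_mul α (x y : B α) : inject x ∘ inject y = inject (x ∘ y) :> S.
Proof.
rewrite [LHS]/bmul /= /ss_mul /=; move: (leIl _ _) (leIr _ _).
by rewrite meetxx => h k; rewrite !transition_id.
Qed.

Lemma inject_lambda α (x y : B α) :
  lambda (inject x : S) (inject y) = inject (lambda x y).
Proof. by rewrite /lambda inject_mul [- inject x]/bopp /= inject_add. Qed.

(** The components are disjoint, so the tag of an element decides which [I α] it has to lie in. *)
Lemma bigcup_injectE (I : forall α, set (B α)) (a : S) :
  (\bigcup_(α in [set: Y]) (@inject d Y B α @` @I α)) a <-> @I (tag a) (tagged a).
Proof.
split; first by case=> α _ [x Ix <-].
by case: a => α x /= Ix; exists α => //; exists x.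
Qed.

Section Union.
Variables (I : forall α, set (B α)) (idI : forall α, ideal (@I α)).
Hypothesis stI : forall (α β : Y) (h : β < α),
  transition (ltW h) @` @I α `<=` @I β.
Local Notation J := (\bigcup_(α in [set: Y]) (@inject d Y B α @` @I α)).

Lemma is_restriction_bigcup : is_restriction idI stI J.
Proof.
split=> [|[α x] [β y] e|].
(* Both equations hold by computation, as the restricted transitions act by those of B on underlying
   elements. *)
- by split.
- have eαβ : α = β := congr1 (@tag _ _) e.
  case: β / eαβ y e => y /inject_inj /= e.
  by congr (existT _ _ _); exact: sub_eq.
apply/seteqP; split=> a.
  by case=> -[α x] _ <-; apply/bigcup_injectE; exact: (svalP x).
move=> /bigcup_injectE; case: a => α x /= Ix.
by exists (existT _ α (exist _ x Ix : subBrace (idI α))).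
Qed.

Lemma ideal_bigcup : ideal J.
Proof.
have st α β (h : β <= α) x : @I α x -> @I β (transition h x).
  exact: transition_stable.
split; first split=> [[α e]|a b|a|a b].
- rewrite inject_add => /inject_inj e_idem; apply/bigcup_injectE => /=.
  by have [[+ _ _ _] _ _] := idI α; apply.
- move=> /bigcup_injectE Ia /bigcup_injectE Ib; apply/bigcup_injectE => /=.
  by have [[_ + _ _] _ _] := idI (tag a `&` tag b)%O; apply; apply: st.
- move=> /bigcup_injectE Ia; apply/bigcup_injectE => /=.
  by have [[_ _ + _] _ _] := idI (tag a); apply.
- move=> /bigcup_injectE Ib; apply/bigcup_injectE => /=.
  (* The two copies of a reach the final component along different chains of inequalities.
     Functoriality and proof irrelevance give them the same image, so the element is a genuine
     conjugate there. *)
  rewrite (transition_hom _).1 !transition_opp !transition_trans.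
  set h := le_trans _ _; rewrite (bool_irrelevance h (leIr _ _)).
  have [[_ _ _ +] _ _] := idI (tag a `&` tag b `&` tag a)%O.
  by apply; apply: st.
- split=> [[α e]|a b|a|a b].
  + rewrite inject_mul => /inject_inj e_idem; apply/bigcup_injectE => /=.
    by have [_ [+ _ _ _] _] := idI α; apply.
  + move=> /bigcup_injectE Ia /bigcup_injectE Ib; apply/bigcup_injectE => /=.
    by have [_ [_ + _ _] _] := idI (tag a `&` tag b)%O; apply; apply: st.
  + move=> /bigcup_injectE Ia; apply/bigcup_injectE => /=.
    by have [_ [_ _ + _] _] := idI (tag a); apply.
  + move=> /bigcup_injectE Ib; apply/bigcup_injectE => /=.
    rewrite (transition_hom _).2 !transition_inv !transition_trans.
    set h := le_trans _ _; rewrite (bool_irrelevance h (leIr _ _)).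
    have [_ [_ _ _ +] _] := idI (tag a `&` tag b `&` tag a)%O.
    by apply; apply: st.
- move=> a b /bigcup_injectE Ib; apply/bigcup_injectE => /=.
  rewrite (transition_hom _).2 !transition_opp !transition_trans.
  (* Here too both occurrences of a must have one image, so that a value of [lambda] appears. *)
  set h := leIl _ _; set k := le_trans _ _; rewrite (bool_irrelevance h k).
  by have [_ _ +] := idI (tag a `&` (tag a `&` tag b))%O; apply; apply: st.
Qed.

End Union.

Section Components.
Variables (J : set S) (idJ : ideal J).

Definition component_part α : set (B α) := [set x | J (inject x)].

Lemma ideal_component_part α : ideal (@component_part α).
Proof.
have [[aE aD aN aJ] [mE mM mV mJ] lJ] := idJ.
rewrite /component_part; split; first split.
- by move=> e e_idem; apply: aE; rewrite inject_add e_idem.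
- by move=> x y Jx Jy; rewrite /= -inject_add; exact: aD.
- by move=> x; exact: aN.
- by move=> x y Jy; rewrite /= -!inject_add; exact: (aJ (inject x)).
- split.
  + by move=> e e_idem; apply: mE; rewrite inject_mul e_idem.
  + by move=> x y Jx Jy; rewrite /= -inject_mul; exact: mM.
  + by move=> x; exact: mV.
  + by move=> x y Jy; rewrite /= -!inject_mul; exact: (mJ (inject x)).
- by move=> x y Jy; rewrite /= -inject_lambda; exact: lJ.
Qed.

(* The transition is addition of an idempotent of the target component. *)
Lemma component_part_stable α β (h : β <= α) :
  transition h @` @component_part α `<=` @component_part β.
Proof.
move=> _ [x Jx <-]; rewrite /component_part /=.
have [[aE aD _ _] _ _] := idJ.
have [A V1 V2 _] := @badd_inverse (B β).
set y := transition h x.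
(* [- y + y] is the zero of B β. The sum lies over the meet of α and β, which is β, so x is moved by
   h and the zero stays fixed. *)
have -> : inject y = inject x + inject (- y + y) :> S.
  rewrite [RHS]/badd /= /ss_add /=; move: (leIl _ _) (leIr _ _).
  rewrite (meet_r h) => h' k; rewrite transition_id (bool_irrelevance h' h).
  by rewrite A V1.
by apply: aD => //; apply: aE; rewrite inject_add A V2.
Qed.

End Components.
End IdealsOfStrongSemilattices.

Theorem theorem3p2 (d : Order.disp_t) (Y : meetSemilatticeType d)
    (B : braceSystem Y) :
  (forall (I : forall α : Y, set (B α))
      (idI : forall α : Y, ideal (I α))
      (stI : forall (α β : Y) (h : β < α), transition (ltW h) @` I α `<=` I β),
    let J := \bigcup_(α in [set: Y]) (@inject d Y B α @` I α) in
    is_restriction idI stI J /\ ideal J)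
  /\
  (forall J : set (strongSemilattice B), ideal J ->
    exists (I : forall α : Y, set (B α))
      (idI : forall α : Y, ideal (I α))
      (stI : forall (α β : Y) (h : β < α), transition (ltW h) @` I α `<=` I β),
      J = \bigcup_(α in [set: Y]) (@inject d Y B α @` I α)
      /\ is_restriction idI stI J).
Proof.
split=> [I idI stI J|J idJ].
  by split; [exact: is_restriction_bigcup | exact: ideal_bigcup].
have stI (α β : Y) (h : β < α) :
    transition (ltW h) @` component_part J (α := α) `<=` component_part J (α := β).
  exact: component_part_stable.
exists (@component_part d Y B J), (ideal_component_part idJ), stI.
have JE : J = \bigcup_(α in [set: Y]) (@inject d Y B α @` component_part J (α := α)).
  apply/seteqP; split=> -[α x] Jx; first exact/bigcup_injectE.
  by move/bigcup_injectE: Jx.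
(* J also occurs inside [component_part J], so only the last argument is rewritten. *)
by split=> //; rewrite [X in is_restriction _ _ X]JE; exact: is_restriction_bigcup.
Qed.
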